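(* Let $A\in\mathbb{R}^{d\times n}$ have columns $a_1,\dots,a_n$, let $\triangle=\{x\in\mathbb{R}^n : x_i\ge 0,\ \sum_i x_i=1\}$, and let $f:\mathbb{R}^d\to\mathbb{R}$ be differentiable, convex, $L$-smooth and $\mu$-strongly convex ($\mu>0$) over $\triangle$. Let $x^\star$ be an optimal solution of $\min_{x\in\triangle}f(Ax)$. Then for every $x\in\triangle$ and every $i\in\{1,\dots,n\}$, $$(a_i-Ax)^\top\nabla f(Ax)>L\sqrt{\frac{G_{\triangle}(x)}{\mu}}\;\|a_i-Ax\|_2\ \Longrightarrow\ x_i^\star=0 ,$$ where $G_{\triangle}(x)$ is the Wolfe gap.
   Context: For a bounded constraint set $\mathcal{C}\subset\mathbb{R}^n$ and $x\in\mathcal{C}$, the Wolfe gap is $G_{\mathcal{C}}(x)=\max_{y\in\mathcal{C}}(Ax-Ay)^\top\nabla f(Ax)$. ''$f$ is $L$-smooth (resp. $\mu$-strongly convex) over $\mathcal{C}$'' means that on the image set $\{Ax: x\in\mathcal{C}\}$ the gradient satisfies $\|\nabla f(u)-\nabla f(v)\|_2\le L\|u-v\|_2$ (resp. $f(u)\ge f(v)+\nabla f(v)^\top(u-v)+\frac{\mu}{2}\|u-v\|_2^2$) for all $u,v$ in that image. *)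

(* Defs.v *)
From HB Require Import structures.
From mathcomp Require Import all_boot all_order all_algebra.
From mathcomp Require Import all_classical all_reals all_analysis.

Set Implicit Arguments.
Unset Strict Implicit.
Unset Printing Implicit Defensive.

Import Order.TTheory GRing.Theory Num.Theory.
Import numFieldNormedType.Exports.

Local Open Scope classical_set_scope.
Local Open Scope ring_scope.

Definition dotp (R : realType) (d : nat) (u v : 'cV[R]_d) : R :=
  (u^T *m v) 0 0.

(* The library norm `|u| on matrices is the sup norm, hence this Euclidean
   norm. Differentiability does not depend on the choice between the two. *)
Definition l2norm (R : realType) (d : nat) (u : 'cV[R]_d) : R :=
  Num.sqrt (dotp u u).

Definition gradient (R : realType) (d : nat) (f : 'cV[R]_d -> R)
    (u : 'cV[R]_d) : 'cV[R]_d :=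
  \col_(i < d) 'D_(delta_mx i 0) f u.

Definition std_simplex (R : realType) (n : nat) : set 'cV[R]_n :=
  [set x | (forall i, 0 <= x i 0) /\ \sum_(i < n) x i 0 = 1].
Arguments std_simplex : clear implicits.

Definition lin_image (R : realType) (d n : nat) (A : 'M[R]_(d, n))
    (C : set 'cV[R]_n) : set 'cV[R]_d :=
  [set A *m x | x in C].

Definition smooth_over (R : realType) (d n : nat) (A : 'M[R]_(d, n))
    (C : set 'cV[R]_n) (L : R) (f : 'cV[R]_d -> R) : Prop :=
  forall u v, lin_image A C u -> lin_image A C v ->
    l2norm (gradient f u - gradient f v) <= L * l2norm (u - v).

Definition strongly_convex_over (R : realType) (d n : nat) (A : 'M[R]_(d, n))
    (C : set 'cV[R]_n) (mu : R) (f : 'cV[R]_d -> R) : Prop :=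
  forall u v, lin_image A C u -> lin_image A C v ->
    f v + dotp (gradient f v) (u - v) + mu / 2 * l2norm (u - v) ^+ 2 <= f u.

Definition optimal_solution (R : realType) (n : nat) (C : set 'cV[R]_n)
    (g : 'cV[R]_n -> R) (x : 'cV[R]_n) : Prop :=
  C x /\ forall y, C y -> g x <= g y.

(* A real supremum: it is the maximum when the latter exists, in particular
   on the simplex (wolfe_gap_simplex_max). *)
Definition wolfe_gap (R : realType) (d n : nat) (A : 'M[R]_(d, n))
    (f : 'cV[R]_d -> R) (C : set 'cV[R]_n) (x : 'cV[R]_n) : R :=
  sup [set dotp (A *m x - A *m y) (gradient f (A *m x)) | y in C].

Lemma wolfe_gap_simplex_max (R : realType) (d n : nat) (A : 'M[R]_(d, n))
    (f : 'cV[R]_d -> R) (x : 'cV[R]_n) : std_simplex R n x ->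
  let G := wolfe_gap A f (std_simplex R n) x in
  (exists2 y, std_simplex R n y &
     G = dotp (A *m x - A *m y) (gradient f (A *m x))) /\
  (forall y, std_simplex R n y ->
     dotp (A *m x - A *m y) (gradient f (A *m x)) <= G).
Proof.
move=> [x0 x1].
pose g := gradient f (A *m x); pose c := A^T *m g.
have E y : dotp (A *m x - A *m y) g = \sum_j x j 0 * c j 0 - \sum_j y j 0 * c j 0.
  rewrite /dotp -mulmxBr trmx_mul -mulmxA -/c mxE -sumrB.
  by apply: eq_bigr => j _; rewrite !mxE mulrBl.
have [i0 _] : exists i : 'I_n, true.
  case: n A x x0 x1 @g @c E => [|m] A x x0 x1 g c E; last by exists ord0.
  by move/eqP: x1; rewrite big_ord0 eq_sym oner_eq0.
pose i := [arg min_(j < i0) c j 0]%O.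
have ci j : c i 0 <= c j 0.
  by rewrite /i; case: arg_minP => // k _; apply.
have De : std_simplex R n (delta_mx i 0).
  split=> [j|]; first by rewrite mxE eqxx andbT ler0n.
  rewrite (bigD1 i)//= mxE !eqxx big1 ?addr0// => j /negPf ji.
  by rewrite mxE ji.
have Ee : \sum_j (delta_mx i 0 : 'cV[R]_n) j 0 * c j 0 = c i 0.
  rewrite (bigD1 i)//= mxE !eqxx mul1r big1 ?addr0// => j /negPf ji.
  by rewrite mxE ji mul0r.
pose S := [set dotp (A *m x - A *m y) g | y in std_simplex R n].
have ubS : ubound S (dotp (A *m x - A *m delta_mx i 0) g).
  move=> _ [y [y0 y1] <-]; rewrite !E Ee lerD2l lerN2.
  rewrite -[c i 0]mul1r -y1 mulr_suml.
  by apply: ler_sum => j _; rewrite ler_wpM2l.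
have SS : S (dotp (A *m x - A *m delta_mx i 0) g) by exists (delta_mx i 0).
have hS : has_sup S by split; [exists (dotp (A *m x - A *m delta_mx i 0) g)
  | exists (dotp (A *m x - A *m delta_mx i 0) g)].
have supE : sup S = dotp (A *m x - A *m delta_mx i 0) g.
  apply/eqP; rewrite eq_le ge_sup//=; last by case: hS.
  exact: (ub_le_sup hS.2).
split; first by exists (delta_mx i 0).
by move=> y Dy; apply: (ub_le_sup hS.2); exists y.
Qed.

(* Main.v *)
Require Import Defs.
From mathcomp Require Import all_boot all_order all_algebra.
From mathcomp Require Import all_classical all_reals all_analysis.
From mathcomp Require Import lra.
Import Order.TTheory GRing.Theory Num.Theory.
Import numFieldNormedType.Exports.
Local Open Scope classical_set_scope.
Local Open Scope ring_scope.

Set Implicit Arguments.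
Unset Strict Implicit.

(** Write u = Ax, v = Ay where y is the optimal solution, g and h for the
    gradients of f at u and v, and r = |u - v|.  Adding the strong convexity
    inequalities for (u, v) and (v, u) and using h.(u - v) >= 0 gives
    mu r^2 <= g.(u - v) <= G, so r <= sqrt (G / mu).  If y_i > 0, then y can be
    moved slightly away from the i-th vertex inside the simplex, so
    h.(a_i - v) <= 0, and therefore
    g.(a_i - u) <= (g - h).(a_i - u) + h.(v - u) <= L r |a_i - u|. *)

Lemma dotpC (R : realType) (d : nat) (u v : 'cV[R]_d) : dotp u v = dotp v u.
Proof.
by rewrite /dotp !mxE; apply: eq_bigr => j _; rewrite !mxE mulrC.
Qed.

Lemma dotpDl (R : realType) (d : nat) (u v w : 'cV[R]_d) :
  dotp (u + v) w = dotp u w + dotp v w.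
Proof. by rewrite /dotp linearD/= mulmxDl mxE. Qed.

Lemma dotpZl (R : realType) (d : nat) (a : R) (u v : 'cV[R]_d) :
  dotp (a *: u) v = a * dotp u v.
Proof. by rewrite /dotp linearZ/= -scalemxAl mxE. Qed.

Lemma dotpNl (R : realType) (d : nat) (u v : 'cV[R]_d) :
  dotp (- u) v = - dotp u v.
Proof. by rewrite -scaleN1r dotpZl mulN1r. Qed.

Lemma dotpBl (R : realType) (d : nat) (u v w : 'cV[R]_d) :
  dotp (u - v) w = dotp u w - dotp v w.
Proof. by rewrite dotpDl dotpNl. Qed.

Lemma dotpBr (R : realType) (d : nat) (u v w : 'cV[R]_d) :
  dotp u (v - w) = dotp u v - dotp u w.
Proof. by rewrite dotpC dotpBl !(dotpC _ u). Qed.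

Lemma dotpZr (R : realType) (d : nat) (a : R) (u v : 'cV[R]_d) :
  dotp u (a *: v) = a * dotp u v.
Proof. by rewrite dotpC dotpZl dotpC. Qed.

Lemma dotpE (R : realType) (d : nat) (u v : 'cV[R]_d) :
  dotp u v = \sum_i u i 0 * v i 0.
Proof. by rewrite /dotp mxE; apply: eq_bigr => j _; rewrite mxE. Qed.

Lemma dotpp_ge0 (R : realType) (d : nat) (u : 'cV[R]_d) : 0 <= dotp u u.
Proof. by rewrite dotpE; apply: sumr_ge0 => j _; rewrite -expr2 sqr_ge0. Qed.

Lemma l2norm_ge0 (R : realType) (d : nat) (u : 'cV[R]_d) : 0 <= l2norm u.
Proof. exact: sqrtr_ge0. Qed.

Lemma sqr_l2norm (R : realType) (d : nat) (u : 'cV[R]_d) :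
  l2norm u ^+ 2 = dotp u u.
Proof. exact/sqr_sqrtr/dotpp_ge0. Qed.

Lemma l2normZ (R : realType) (d : nat) (a : R) (u : 'cV[R]_d) :
  0 <= a -> l2norm (a *: u) = a * l2norm u.
Proof.
move=> a0.
rewrite /l2norm dotpZl dotpZr mulrA -expr2 sqrtrM ?sqr_ge0//.
by rewrite sqrtr_sqr ger0_norm.
Qed.

Lemma l2normN (R : realType) (d : nat) (u : 'cV[R]_d) :
  l2norm (- u) = l2norm u.
Proof. by rewrite /l2norm dotpNl dotpC dotpNl opprK. Qed.

Lemma l2norm_eq0 (R : realType) (d : nat) (u : 'cV[R]_d) :
  l2norm u = 0 -> u = 0.
Proof.
move=> u0; have := sqr_l2norm u.
rewrite u0 expr0n/= dotpE => /esym/eqP.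
rewrite psumr_eq0 => [/allP h|j _]; last by rewrite -expr2 sqr_ge0.
apply/matrixP => j k; rewrite (ord1 k) mxE.
by apply/eqP; have := h j (mem_index_enum j); rewrite mulf_eq0 orbb.
Qed.

Lemma dotp_le_l2norm (R : realType) (d : nat) (u v : 'cV[R]_d) :
  dotp u v <= l2norm u * l2norm v.
Proof.
have d0 (w : 'cV[R]_d) : dotp 0 w = 0 by rewrite -(scale0r 0) dotpZl mul0r.
have [/l2norm_eq0 ->|u0] := eqVneq (l2norm u) 0.
  by rewrite d0 mulr_ge0 ?l2norm_ge0.
have [/l2norm_eq0 ->|v0] := eqVneq (l2norm v) 0.
  by rewrite dotpC d0 mulr_ge0 ?l2norm_ge0.
have p_gt0 : 0 < l2norm u * l2norm v by rewrite mulr_gt0 ?lt0r ?u0 ?v0 ?l2norm_ge0.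
(* Cauchy-Schwarz: with p = |u| |v|, this square expands to 2 p (p - u.v), and p > 0 can be divided
   out. *)
have := dotpp_ge0 (l2norm v *: u - l2norm u *: v).
rewrite !(dotpBl, dotpBr, dotpZl, dotpZr) (dotpC v u) -!sqr_l2norm => h.
rewrite -(ler_pM2l p_gt0); nra.
Qed.

Section ConstrainedMinimum.
Variables (R : realType) (d n : nat) (A : 'M[R]_(d, n)) (C : set 'cV[R]_n).
Variables (f : 'cV[R]_d -> R) (L mu : R) (xs : 'cV[R]_n).
Hypotheses (f_smooth : smooth_over A C L f) (mu_gt0 : 0 < mu)
  (f_strong : strongly_convex_over A C mu f)
  (xs_opt : optimal_solution C (fun x => f (A *m x)) xs).

(* Strong convexity at the perturbed points and the Lipschitz bound on the
   gradient give first-order optimality without differentiating f. *)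
Lemma optimal_feasible_direction (w : 'cV[R]_n) (e : R) : 0 < e ->
  (forall t, 0 < t -> t <= e -> C (xs + t *: w)) ->
  0 <= dotp (A *m w) (gradient f (A *m xs)).
Proof.
move=> e0 feas; have [Cxs xs_min] := xs_opt.
(* Strong convexity based at the perturbed point, together with minimality of [xs], makes the slope
   along [A *m w] nonnegative there. Moving the gradient back to [A *m xs] costs at most t L
   |Aw|^2. *)
have bnd t : 0 < t -> t <= e ->
    - (t * (L * l2norm (A *m w) ^+ 2)) <= dotp (A *m w) (gradient f (A *m xs)).
  move=> t0 te; have Ct := feas _ t0 te.
  have It : lin_image A C (A *m (xs + t *: w)) by exists (xs + t *: w).
  have Is : lin_image A C (A *m xs) by exists xs.
  have E : A *m (xs + t *: w) - A *m xs = t *: (A *m w).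
    by rewrite mulmxDr -scalemxAr addrC addKr.
  have sm := f_smooth It Is.
  have sc := f_strong Is It.
  have mi := xs_min _ Ct.
  have CS := dotp_le_l2norm (A *m w)
    (gradient f (A *m (xs + t *: w)) - gradient f (A *m xs)).
  have E' : A *m xs - A *m (xs + t *: w) = - (t *: (A *m w)).
    by rewrite -E opprB.
  rewrite E l2normZ ?(ltW t0)// in sm.
  rewrite E' dotpC dotpNl dotpZl in sc.
  rewrite dotpBr in CS.
  have q0 : 0 <= mu / 2 * l2norm (- (t *: (A *m w))) ^+ 2.
    by rewrite mulr_ge0 ?sqr_ge0// divr_ge0// ltW.
  have pos : 0 <= dotp (A *m w) (gradient f (A *m (xs + t *: w))).
    by rewrite -(pmulr_rge0 _ t0); lra.
  have := ler_wpM2l (l2norm_ge0 (A *m w)) sm.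
  rewrite expr2; lra.
rewrite leNgt; apply/negP => neg.
set D := dotp _ _ in bnd neg; set K := L * _ in bnd.
have K1 : 0 < `|K| + 1 by rewrite ltr_wpDl.
(* This t is feasible and gives t K < - D, against [bnd]. The absolute value covers a negative [K],
   and the added 1 keeps the denominator positive when [K] is 0. *)
pose t := Num.min e (- D / (2 * (`|K| + 1))).
have t0 : 0 < t by rewrite lt_min e0 divr_gt0 ?oppr_gt0// mulr_gt0.
have := bnd t t0; rewrite /t ge_min lexx/= -/t => /(_ isT) h.
have tD : t * (2 * (`|K| + 1)) <= - D.
  by rewrite -ler_pdivlMr ?mulr_gt0// ge_min lexx orbT.
have tK : t * K <= t * `|K| by rewrite ler_pM2l// ler_norm.
lra.
Qed.

Lemma optimal_gradient_ge0 (y : 'cV[R]_n) :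
  (forall t, 0 < t -> t <= 1 -> C (xs + t *: (y - xs))) ->
  0 <= dotp (A *m y - A *m xs) (gradient f (A *m xs)).
Proof. by rewrite -mulmxBr; exact: optimal_feasible_direction. Qed.

Lemma dist_optimal_le (x : 'cV[R]_n) : C x ->
  0 <= dotp (A *m x - A *m xs) (gradient f (A *m xs)) ->
  mu * l2norm (A *m x - A *m xs) ^+ 2
    <= dotp (A *m x - A *m xs) (gradient f (A *m x)).
Proof.
move=> Cx opt; have [Cxs _] := xs_opt.
have Ix : lin_image A C (A *m x) by exists x.
have Is : lin_image A C (A *m xs) by exists xs.
(* In the sum the values of f cancel and the two terms in mu / 2 combine. *)
have h1 := f_strong Ix Is; have h2 := f_strong Is Ix.
rewrite dotpC in h1.
rewrite -(opprB (A *m x)) dotpC dotpNl l2normN in h2.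
lra.
Qed.

End ConstrainedMinimum.

Lemma std_simplex_segment (R : realType) (n : nat) (x y : 'cV[R]_n) (t : R) :
  std_simplex R n x -> std_simplex R n y -> 0 <= t -> t <= 1 ->
  std_simplex R n (x + t *: (y - x)).
Proof.
move=> [x0 x1] [y0 y1] t0 t1; split=> [j|].
  by rewrite !mxE; have := x0 j; have := y0 j; nra.
under eq_bigr do rewrite !mxE.
by rewrite big_split/= -mulr_sumr sumrB x1 y1 subrr mulr0 addr0.
Qed.

Lemma std_simplex_delta (R : realType) (n : nat) (i : 'I_n) :
  std_simplex R n (delta_mx i 0).
Proof.
split=> [j|]; first by rewrite mxE eqxx andbT ler0n.
rewrite (bigD1 i)//= mxE !eqxx big1 ?addr0// => j /negPf ji.
by rewrite mxE ji.
Qed.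

(** Coordinates other than i are multiplied by 1 + t. Coordinate i becomes (x_i - t) + t x_i, which
    the bound on t keeps nonnegative. *)
Lemma std_simplex_away_vertex (R : realType) (n : nat) (x : 'cV[R]_n)
    (i : 'I_n) (t : R) :
  std_simplex R n x -> 0 <= t -> t <= x i 0 ->
  std_simplex R n (x + t *: (x - delta_mx i 0)).
Proof.
move=> [x0 x1] t0 ti; split=> [j|].
  rewrite !mxE eqxx andbT; have := x0 j.
  by have [->|_] := eqVneq j i; rewrite ?mulr1n ?mulr0n; nra.
have [_ d1] := std_simplex_delta R i.
under eq_bigr do rewrite mxE mxE mxE [(- delta_mx i 0 : 'cV_n) _ _]mxE.
by rewrite big_split/= -mulr_sumr sumrB x1 d1 subrr mulr0 addr0.
Qed.

Theorem theorem7 (R : realType) (d n : nat) (A : 'M[R]_(d, n))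
    (f : 'cV[R]_d -> R) (L mu : R) (xstar : 'cV[R]_n)
    (f_diff : forall u, differentiable f u)
    (f_convex : convex_function [set: 'cV[R]_d] f)
    (f_smooth : smooth_over A (std_simplex R n) L f)
    (mu_gt0 : 0 < mu)
    (f_strong : strongly_convex_over A (std_simplex R n) mu f)
    (xstar_opt : optimal_solution (std_simplex R n)
                   (fun x => f (A *m x)) xstar)
    (x : 'cV[R]_n) (x_simplex : std_simplex R n x) (i : 'I_n) :
  dotp (col i A - A *m x) (gradient f (A *m x)) >
    L * Num.sqrt (wolfe_gap A f (std_simplex R n) x / mu)
      * l2norm (col i A - A *m x) ->
  xstar i 0 = 0.
Proof.
move=> big; apply/eqP/negPn/negP => xi_neq0; move: big; apply/negP.
rewrite -leNgt; have [Cs _] := xstar_opt.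
have xi_gt0 : 0 < xstar i 0 by rewrite lt0r xi_neq0 Cs.1.
have colE : col i A = A *m delta_mx i 0 by rewrite colE.
rewrite colE; set a := A *m delta_mx i 0; set u := A *m x.
pose v := A *m xstar; pose g := gradient f u; pose gs := gradient f v.
have Ia : lin_image A (std_simplex R n) a.
  by exists (delta_mx i 0) => //; exact: std_simplex_delta.
have Iu : lin_image A (std_simplex R n) u by exists x.
have Iv : lin_image A (std_simplex R n) v by exists xstar.
have opt_u : 0 <= dotp (u - v) gs.
  apply: (optimal_gradient_ge0 f_smooth mu_gt0 f_strong xstar_opt) => t t0 t1.
  exact: std_simplex_segment (ltW t0) t1.
(* Here positivity of the i-th coordinate enters: it is the admissible step length in the direction
   away from the vertex. *)
have opt_a : 0 <= dotp (v - a) gs.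
  rewrite /v /a -mulmxBr.
  apply: (optimal_feasible_direction f_smooth mu_gt0 f_strong xstar_opt xi_gt0).
  by move=> t t0 ti; exact: std_simplex_away_vertex (ltW t0) ti.
(* [xstar] is itself a competitor in the maximum defining the Wolfe gap. *)
have r_le : l2norm (u - v) <= Num.sqrt (wolfe_gap A f (std_simplex R n) x / mu).
  rewrite -[leLHS]ger0_norm ?l2norm_ge0// -sqrtr_sqr ler_wsqrtr//.
  rewrite ler_pdivlMr// mulrC.
  apply: le_trans (dist_optimal_le f_strong xstar_opt x_simplex opt_u) _.
  exact: (wolfe_gap_simplex_max A f x_simplex).2.
(* The sign of L is unknown; smoothness between a_i and u supplies what is
   needed. *)
have La : 0 <= L * l2norm (a - u).
  exact: le_trans (l2norm_ge0 _) (f_smooth _ _ Ia Iu).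
have CS := dotp_le_l2norm (a - u) (g - gs).
have sm := ler_wpM2l (l2norm_ge0 (a - u)) (f_smooth _ _ Iu Iv).
(* The conclusion splits (a - u).g as (a - u).(g - gs) + (a - v).gs + (v - u).gs; the last two terms
   are nonpositive by [opt_a] and [opt_u]. *)
have := ler_wpM2l La r_le.
rewrite !(dotpBl, dotpBr) -/u -/g -/gs in CS sm opt_u opt_a *.
lra.
Qed.
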